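(* For each integer $\ell\ge1$, $\mathrm{V}^{\ell}(x)=O_{\ell}\!\left(\dfrac{x}{\log x}(\log\log x)^{\ell}\right)$ as $x\to\infty$.
   Context: $\phi$ is Euler's totient function, $\mathscr{V}$ its set of values, $\mathscr{V}^{\ell}=\{m\in\mathscr{V}: m\equiv 2^{\ell}\pmod{2^{\ell+1}}\}$, and $\mathrm{V}^{\ell}(x)=|\{m\in\mathscr{V}^{\ell}: m\le x\}|$. The implied constant depends on $\ell$. *)

(* Defs.v *)
From mathcomp Require Import all_boot all_order all_algebra.
From mathcomp Require Import finmap.
From mathcomp Require Import all_classical all_reals all_analysis.

Set Implicit Arguments.
Unset Strict Implicit.
Unset Printing Implicit Defensive.

Import Order.TTheory GRing.Theory Num.Theory.
Import numFieldNormedType.Exports.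

Local Open Scope classical_set_scope.
Local Open Scope ring_scope.

(* Positive arguments only: [totient 0 = 0] is an artefact of the library. *)
Definition totient_values : set nat := totient @` [set n | (0 < n)%N].

Definition totient_values_at (l : nat) : set nat :=
  totient_values `&` [set m | m = 2 ^ l %[mod 2 ^ l.+1]].

Definition totient_values_at_upto (R : realType) (l : nat) (x : R) : set nat :=
  totient_values_at l `&` [set m | m%:R <= x].

(* [fset_set] returns the empty set on infinite sets; this never happens below. *)
Lemma finite_totient_values_at_upto (R : realType) (l : nat) (x : R) :
  finite_set (totient_values_at_upto l x).
Proof.
apply: (@sub_finite_set _ _ `I_(Num.bound x)); last exact: finite_II.
move=> m [_ /= mx]; have [x0|x0] := leP 0 x.
  by rewrite -(ltr_nat R); apply: (le_lt_trans mx); exact: archi_boundP.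
by have := le_lt_trans mx x0; rewrite ltrn0.
Qed.

Definition totient_count_at (R : realType) (l : nat) (x : R) : nat :=
  #|` fset_set (totient_values_at_upto l x)|%fset.

(* Gives access to the notation [f =O_ +oo g]. *)
Canonical pinfty_nbhs_filterType (R : realType) :=
  FilterType (pinfty_nbhs R) _.

(* Main.v *)
(* If m = phi(n) is exactly divisible by 2^l, then n has at most l + 1 distinct
   prime factors, since every odd one contributes a factor 2 to phi(n); hence
   also n <= 2^(l+1) phi(n), and it suffices to count integers n < X with at
   most k + 1 = l + 1 prime factors.  Write n = q m, where q is the largest
   prime power exactly dividing n, so that m <= q^k.  For fixed m, this forces
   X/m to be at least a fixed power of X, so Chebyshev's estimate, applied to
   prime powers up to X/m, leaves O((X/m) / log X) choices for q.  Finally the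
   sum of 1/m over the cofactors m is at most the k-th power of the sum of 1/q
   over prime powers q < X, which is O(log log X) by Chebyshev on the blocks
   [4^j, 4^(j+1)). *)

Require Import Defs.
From mathcomp Require Import all_boot all_order all_algebra.
From mathcomp Require Import finmap.
From mathcomp Require Import all_classical all_reals all_analysis.
From mathcomp Require Import zify ring lra.

Import Order.TTheory GRing.Theory Num.Theory.
Import numFieldNormedType.Exports.

(** * Integers with a bounded number of prime factors *)

(* [almost_primes 1 N] is the list of prime powers below [N], including 1. *)
Definition almost_primes (k N : nat) : seq nat :=
  [seq n <- index_iota 1 N | size (primes n) <= k].

Lemma mem_almost_primes k N n :
  (n \in almost_primes k N) = [&& 0 < n, n < N & size (primes n) <= k].
Proof. by rewrite mem_filter mem_index_iota andbC andbA. Qed.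

Lemma almost_primes_uniq k N : uniq (almost_primes k N).
Proof. by rewrite filter_uniq ?iota_uniq. Qed.

(** * Chebyshev's upper bound for primes and prime powers *)

Lemma prod_primes_dvd (s : seq nat) n :
  uniq s -> all prime s -> {in s, forall p, p %| n} -> \prod_(p <- s) p %| n.
Proof.
elim: s => [|p s IH] /=; first by rewrite big_nil dvd1n.
case/andP=> ps us /andP[pp pps] sn; rewrite big_cons Gauss_dvd.
  rewrite sn ?mem_head //=; apply: IH => // q qs; apply: sn.
  by rewrite inE qs orbT.
rewrite big_seq; apply: (big_ind (coprime p)) => [|a b|q qs].
- exact: coprimen1.
- by rewrite coprimeMr => -> ->.
rewrite prime_coprime // dvdn_prime2 ?(allP pps q) //.
by apply: contraNneq ps => ->.
Qed.

Lemma prime_dvd_fact p n : prime p -> p %| n`! -> p <= n.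
Proof.
move=> pp; elim: n => [|n IH].
  by rewrite fact0 dvdn1 => /eqP p1; rewrite p1 in pp.
by rewrite factS Euclid_dvdM // => /orP[/dvdn_leq->//|/IH/leqW].
Qed.

(** A prime in (n, 2n] divides (2n)! but not n!, hence divides the central binomial coefficient,
    which is at most (1 + 1)^(2n). *)
Lemma primorial_double n :
  \prod_(n.+1 <= p < n.*2.+1 | prime p) p <= 4 ^ n.
Proof.
have h : \prod_(n.+1 <= p < n.*2.+1 | prime p) p %| 'C(n.*2, n).
  rewrite -big_filter; apply: prod_primes_dvd.
  - by rewrite filter_uniq ?iota_uniq.
  - exact: filter_all.
  move=> p; rewrite mem_filter mem_index_iota => /and3P[pp np pn].
  have := bin_fact (leq_trans (leqnn n) (leq_addr n n)).
  rewrite addnn -{2}addnn addnK => e.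
  have : p %| n.*2`! by rewrite dvdn_fact // prime_gt0.
  rewrite -e !Euclid_dvdM // => /or3P[] //.
    by move/(prime_dvd_fact _ _ pp); rewrite leqNgt np.
  by move/(prime_dvd_fact _ _ pp); rewrite leqNgt np.
apply: leq_trans (dvdn_leq _ h) _; first by rewrite bin_gt0 -addnn leq_addr.
rewrite -[4]/(2 ^ 2) -expnM mul2n -[2]/(1 + 1) expnDn.
have nn : n < n.*2.+1 by rewrite ltnS -addnn leq_addr.
by rewrite (bigD1 (Ordinal nn)) //= !exp1n !muln1 leq_addr.
Qed.

Lemma primorial_pow2 k : \prod_(1 <= p < (2 ^ k).+1 | prime p) p <= 4 ^ 2 ^ k.
Proof.
elim: k => [|k IH]; first by rewrite big_mkcond big_nat1.
rewrite (big_cat_nat (n := (2 ^ k).+1)) //=; last by rewrite ltnS leq_exp2l.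
rewrite expnS mul2n -{2}addnn expnD leq_mul //.
exact: primorial_double.
Qed.

(** Chebyshev's bound X / log X at X = [4 ^ j], with the logarithm multiplied out to stay in
    [nat]. *)
Lemma prime_power_count j : j * size (almost_primes 1 (4 ^ j)) <= 6 * 4 ^ j.
Proof.
have e4 : 4 ^ j = 2 ^ j * 2 ^ j by rewrite -expnD addnn -mul2n expnM.
(* A prime power below [4 ^ j] is a prime above [2 ^ j], or has base at most
   [2 ^ j] and exponent below [2 * j]. *)
set S := [seq p <- index_iota (2 ^ j).+1 (4 ^ j).+1 | prime p].
set T := [seq p ^ a | p <- iota 1 (2 ^ j), a <- iota 0 (2 * j)].
have sub : {subset almost_primes 1 (4 ^ j) <= S ++ T}.
  move=> q; rewrite mem_almost_primes mem_cat => /and3P[q0 qj].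
  have := prod_prime_decomp q0; rewrite prime_decompE.
  case: primes (mem_primes^~ q) => [|p [|//]] hp /=;
    rewrite ?big_nil ?big_cons ?muln1 /=.
    move=> q1 _; apply/orP; right; apply/allpairsP.
    exists (1, 0); split=> //=; rewrite ?mem_iota ?add0n ?add1n ?ltnS ?expn_gt0 //.
    by case: j qj {hp e4 S T} => //; rewrite expn0 q1.
  rewrite big_nil muln1.
  have := hp p; rewrite inE eqxx => /esym/and3P[pp _ pq] qe _.
  set a := logn p q in qe.
  have a0 : 0 < a by rewrite logn_gt0 mem_primes pp q0.
  case: (leqP p (2 ^ j)) => pj; apply/orP; [right|left].
    apply/allpairsP; exists (p, a); split;
      rewrite // mem_iota ?add0n ?add1n ?prime_gt0 //=.
    rewrite -(ltn_exp2l (m := 2)) // (leq_ltn_trans _ (_ : q < _)) //.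
      by rewrite qe leq_exp2r ?prime_gt1.
    by rewrite expnM.
  have a1 : a = 1.
    apply/eqP; rewrite eqn_leq a0 andbT leqNgt; apply/negP => a2.
    move: qj; rewrite e4 ltnNge => /negP; apply; rewrite qe.
    apply: leq_trans (_ : p ^ 2 <= _); last by rewrite leq_pexp2l ?prime_gt0.
    by rewrite -mulnn leq_mul // ltnW.
  rewrite mem_filter mem_index_iota qe a1 expn1 pp pj ltnS.
  by move: qj; rewrite qe a1 expn1; exact: ltnW.
have := uniq_leq_size (almost_primes_uniq _ _) sub.
rewrite size_cat size_allpairs !size_iota => le.
(* Each prime in [S] exceeds [2 ^ j], so 2^(j |S|) is at most the primorial of [4 ^ j]. *)
have hS : j * size S <= 2 * 4 ^ j.
  rewrite -(leq_exp2l (m := 2)) // [2 ^ (2 * _)]expnM.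
  have := primorial_pow2 (2 * j); rewrite [2 ^ (_ * _)]expnM; apply: leq_trans.
  rewrite (big_cat_nat (n := (2 ^ j).+1)) //=; last first.
    by rewrite ltnS e4 leq_pmulr ?expn_gt0.
  rewrite expnM -[leqLHS]mul1n leq_mul //.
    by rewrite big_seq_cond; apply: prodn_cond_gt0 => p /andP[_ /prime_gt0].
  rewrite -big_filter -/S.
  have : all (leq (2 ^ j)) S.
    by apply/allP => p; rewrite mem_filter mem_index_iota => /and3P[_ /ltnW].
  elim: S {sub le} => [|p s IH] /=; first by rewrite big_nil.
  by case/andP=> jp /IH; rewrite big_cons expnS; apply: leq_mul.
(* Hence [T] contributes at most 4 * 4^j, which with [hS] gives the constant 6. *)
have j2 : j * j <= 2 * 2 ^ j.
  elim: j {S T sub le hS e4} => // -[|[|[|j]]] // IH; rewrite expnS; lia.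
apply: leq_trans (_ : j * (size S + 2 ^ j * (2 * j)) <= _).
  by rewrite leq_mul2l le orbT.
by nia.
Qed.

(** * Splitting off the largest prime power *)

Lemma seq_argmax (T : eqType) (f : T -> nat) (s : seq T) : 0 < size s ->
  exists2 x, x \in s & {in s, forall y, f y <= f x}.
Proof.
elim: s => [//|x [|y s] IH] _.
  by exists x; rewrite ?mem_head // => y; rewrite inE => /eqP->.
have [//|z zs hz] := IH; case: (leqP (f x) (f z)) => xz.
  exists z => [|t]; first by rewrite in_cons zs orbT.
  by rewrite in_cons => /predU1P[->//|/hz].
exists x; rewrite ?mem_head // => t; rewrite in_cons => /predU1P[->//|/hz h].
exact: leq_trans h (ltnW xz).
Qed.

Lemma almost_prime_split k n : 0 < n -> size (primes n) <= k.+1 ->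
  exists q m, [/\ n = q * m, size (primes q) <= 1, size (primes m) <= k
                & m <= q ^ k].
Proof.
move=> n0; case: (posnP (size (primes n))) => [/size0nil e _|s0 sk].
  exists 1, n; rewrite mul1n e exp1n; split=> //.
  rewrite (prod_prime_decomp n0) prime_decompE e big_nil; exact: leqnn.
have [p pn pmax] := @seq_argmax nat (fun r : nat => n`_r) _ s0.
have /and3P[pp _ _] : [&& prime p, 0 < n & p %| n] by rewrite -mem_primes.
have q0 : 0 < n`_p by exact: part_gt0.
exists n`_p, n`_p^'; rewrite partnC //; split => //.
- by rewrite p_part primesX ?primes_prime // logn_gt0.
- rewrite primes_part size_filter -ltnS (leq_trans _ sk) //.
  rewrite -(count_predC (mem (p : nat_pred)) (primes n)) -add1n leq_add //.
  by rewrite -has_count; apply/hasP; exists p => //; rewrite /= inE.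
(* After multiplication by q the claim is n <= q^(k+1): n has at most k + 1 prime-power components,
   each at most q. *)
rewrite -(leq_pmul2l q0) partnC // -expnS.
apply: leq_trans (leq_pexp2l q0 sk).
rewrite {1}(prod_prime_decomp n0) prime_decompE big_map /=.
elim: (primes n) pmax => [|r s IH] h; first by rewrite big_nil.
rewrite big_cons /= expnS leq_mul -?p_part ?h ?mem_head //.
by apply: IH => t ts; apply: h; rewrite inE ts orbT.
Qed.

(** * Comparing an integer with its totient *)

Lemma primes_pow2_dvd_totient n : 0 < n -> 2 ^ (size (primes n)).-1 %| totient n.
Proof.
move=> n0; rewrite totientE //.
(* Exponents are arbitrary so that the induction can run over the list of primes; the term
   [2 \in s], read as 0 or 1, discounts the prime 2, for which p - 1 is odd. *)
have h (s : seq nat) (e : nat -> nat) : uniq s -> all prime s ->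
    2 ^ (size s - (2 \in s)) %| \prod_(p <- s) (p.-1 * p ^ e p).
  elim: s => [|p s IH] //=.
  case/andP=> ps us /andP[pp pps]; rewrite big_cons inE eq_sym.
  have {IH} := IH us pps.
  case: (eqVneq p 2) ps => [->|p2] ps IH.
    rewrite /= subn1 /= dvdn_mull //; apply: dvdn_trans IH.
    by rewrite (negPf ps) subn0.
  rewrite /= subSn ?expnS; last first.
    by case: (boolP (2 \in s)) => //; case: s {IH us pps ps}.
  rewrite dvdn_mul // dvdn_mulr //.
  by case: (even_prime pp) p2 => [->|] //; case: p pp {ps} => //= p _; rewrite dvdn2.
apply: dvdn_trans (h _ _ (primes_uniq n) _).
  by rewrite dvdn_exp2l // -subn1 leq_sub2l // leq_b1.
by apply/allP => p; rewrite mem_primes => /and3P[].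
Qed.

(** Prime by prime, p^a <= 2 (p - 1) p^(a - 1), because p <= 2 (p - 1). *)
Lemma leq_totient_primes n : 0 < n -> n <= 2 ^ size (primes n) * totient n.
Proof.
move=> n0; rewrite totientE //.
rewrite {1}(prod_prime_decomp n0) prime_decompE big_map /=.
have : {in primes n, forall p, prime p && (0 < logn p n)}.
  by move=> p pn; rewrite logn_gt0 pn; move: pn; rewrite mem_primes => /and3P[->].
elim: (primes n) => [|p s IH] h; first by rewrite !big_nil.
rewrite !big_cons /= expnS mulnACA leq_mul //; last first.
  by apply: IH => r rs; apply: h; rewrite inE rs orbT.
have /andP[pp l0] := h p (mem_head _ _).
rewrite -{1}(prednK l0) expnS mulnA leq_mul2r; apply/orP; right.
by have := prime_gt1 pp; lia.
Qed.

(** * Counting by cofactor *)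

Lemma almost_primes_count_split k N :
  size (almost_primes k.+1 N) <=
    \sum_(m <- almost_primes k N)
      size [seq q <- almost_primes 1 N | (q * m < N) && (m <= q ^ k)].
Proof.
set t := fun m => [seq q <- almost_primes 1 N | (q * m < N) && (m <= q ^ k)].
suff sub : {subset almost_primes k.+1 N <=
             [seq q * m | m <- almost_primes k N, q <- t m]}.
  apply: leq_trans (uniq_leq_size (almost_primes_uniq _ _) sub) _.
  by rewrite size_allpairs_dep sumnE big_map.
move=> n; rewrite mem_almost_primes => /and3P[n0 nN sn].
have [q [m [nqm q1 mk mq]]] := almost_prime_split _ _ n0 sn.
have /andP[q0 m0] : (0 < q) && (0 < m) by rewrite -muln_gt0 -nqm.
apply/allpairsPdep; exists m, q; split=> //.
  rewrite mem_almost_primes m0 mk andbT /=; apply: leq_trans nN.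
  by rewrite nqm ltnS leq_pmull.
rewrite mem_filter mem_almost_primes -nqm nN mq q0 q1 /= andbT.
by apply: leq_trans nN; rewrite nqm ltnS leq_pmulr.
Qed.

Lemma prime_power_cofactor_count k J m : 0 < m ->
  J * size [seq q <- almost_primes 1 (4 ^ J) | (q * m < 4 ^ J) && (m <= q ^ k)]
    * m <= 24 * k.+1 * 4 ^ J.
Proof.
move=> m0; set t := [seq q <- _ | _].
case: (posnP (size t)) => [->|t0]; first by rewrite muln0.
have [q qt] : exists q, q \in t.
  by case: t t0 => [//|q s _]; exists q; rewrite mem_head.
have /and3P[/andP[qm mq] _ _] : [&& (q * m < 4 ^ J) && (m <= q ^ k), true & true].
  by move: qt; rewrite mem_filter => /andP[->].
have q0 : 0 < q.
  by move: qt; rewrite mem_filter mem_almost_primes => /andP[_ /and3P[]].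
set y := 4 ^ J %/ m.
have qy (r : nat) : r * m < 4 ^ J -> r <= y by move=> h; rewrite leq_divRL // ltnW.
have y0 : 0 < y by apply: leq_trans (qy _ qm).
have /andP[iy yi] := trunc_log_bounds (isT : 1 < 4) y0.
set i := trunc_log 4 y in iy yi.
have st : size t <= size (almost_primes 1 (4 ^ i.+1)).
  apply: uniq_leq_size; first by rewrite filter_uniq ?almost_primes_uniq.
  move=> r; rewrite mem_filter !mem_almost_primes.
  case/andP=> /andP[/qy ry _] /and3P[-> _ ->].
  by rewrite (leq_ltn_trans ry yi).
(* As m <= q^k and q <= y < 4^(i+1), 4^J < (y + 1) m <= 4^((i+1)(k+1)); so log y is comparable to
   log X for X = [4 ^ J]. *)
have Ji : J <= k.+1 * i.+1.
  rewrite -(leq_exp2l (m := 4)) // mulnC expnM expnS.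
  apply: ltnW; apply: leq_trans (_ : y.+1 * m <= _); first by rewrite ltn_ceil.
  rewrite leq_mul // (leq_trans mq) //.
  have [->|k0] := posnP k; first by rewrite !expn0.
  by rewrite leq_exp2r // ltnW // (leq_ltn_trans (qy _ qm) yi).
have h := prime_power_count i.+1.
have ym : y * m <= 4 ^ J by rewrite leq_trunc_div.
apply: leq_trans (_ : (k.+1 * (i.+1 * size (almost_primes 1 (4 ^ i.+1)))) * m <= _).
  by rewrite leq_mul2r mulnA leq_mul ?orbT.
(* The 6 is Chebyshev's constant; the 4 is lost in rounding y up to [4 ^ i.+1]. *)
apply: leq_trans (_ : k.+1 * (6 * (4 * y)) * m <= _).
  rewrite leq_mul2r leq_mul2l (leq_trans h) ?orbT //.
  by rewrite expnS !leq_mul2l iy !orbT.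
by nia.
Qed.

Local Open Scope classical_set_scope.
Local Open Scope ring_scope.

(** * Sums of reciprocals *)

Lemma ler_sum_subset (R : numDomainType) (T : eqType) (s t : seq T) (F : T -> R) :
  (forall x, 0 <= F x) -> uniq s -> {subset s <= t} ->
  \sum_(x <- s) F x <= \sum_(x <- t) F x.
Proof.
move=> F0; elim: s t => [|x s IH] t; first by rewrite big_nil sumr_ge0.
case/andP=> xs us st; have xt : x \in t by rewrite st ?mem_head.
rewrite (perm_big _ (perm_to_rem xt)) !big_cons lerD2l IH // => y ys.
have := st y; rewrite (perm_mem (perm_to_rem xt)) !inE ys orbT => /(_ isT).
by case/predU1P=> // yx; rewrite -yx ys in xs.
Qed.

(** Repeated splitting writes n as a product of k prime powers, 1 being allowed, so 1/n occurs in
    the expanded power, whose terms are nonnegative. *)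
Lemma sum_inv_almost_primes (R : realFieldType) k N :
  \sum_(n <- almost_primes k N) n%:R^-1
    <= (\sum_(q <- almost_primes 1 N) q%:R^-1) ^+ k :> R.
Proof.
have inv0 (n : nat) : 0 <= n%:R^-1 :> R by rewrite invr_ge0 ler0n.
elim: k => [|k IH].
  rewrite expr0.
  have sub : {subset almost_primes 0 N <= [:: 1%N]}.
    move=> n; rewrite mem_almost_primes leqn0 size_eq0 => /and3P[n0 _ /eqP pn].
    by rewrite (prod_prime_decomp n0) prime_decompE pn big_nil mem_head.
  apply: le_trans (_ : \sum_(n <- [:: 1%N]) n%:R^-1 <= _); last first.
    by rewrite big_seq1 invr1.
  by apply: ler_sum_subset; rewrite ?almost_primes_uniq.
rewrite exprS; apply: le_trans (ler_wpM2l _ IH); last exact: sumr_ge0.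
rewrite big_distrlr /=.
rewrite [leRHS](_ : _ = \sum_(n <- [seq q * m | q <- almost_primes 1 N,
    m <- almost_primes k N]%N) n%:R^-1); last first.
  rewrite big_allpairs_dep; apply: eq_bigr => q _; apply: eq_bigr => m _.
  by rewrite natrM invfM.
apply: ler_sum_subset; rewrite ?almost_primes_uniq // => n.
rewrite mem_almost_primes => /and3P[n0 nN sn].
have [q [m [nqm q1 mk mq]]] := almost_prime_split _ _ n0 sn.
have /andP[q0 m0] : (0 < q)%N && (0 < m)%N by rewrite -muln_gt0 -nqm.
apply/allpairsP; exists (q, m); rewrite !mem_almost_primes q0 m0 q1 mk !andbT.
by split => //; apply: leq_ltn_trans nN; rewrite nqm ?leq_pmull ?leq_pmulr.
Qed.

(** The block from 4^J to 4^(J+1) holds at most 6 * 4^(J+1) / (J+1) prime powers, each of reciprocal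
    at most 4^(-J): a contribution of 24 / (J+1). *)
Lemma sum_inv_prime_powers (R : realFieldType) J :
  \sum_(q <- almost_primes 1 (4 ^ J)) q%:R^-1
    <= 24 * \sum_(i < J) i.+1%:R^-1 :> R.
Proof.
elim: J => [|J IH].
  by rewrite big_ord0 mulr0 /almost_primes expn0 /= big_nil.
rewrite big_filter (big_cat_nat (n := (4 ^ J)%N)) //=; first last.
- by rewrite leq_exp2l.
- by rewrite expn_gt0.
rewrite big_ord_recr /= mulrDr lerD //; first by rewrite -big_filter.
have p4 : 0 < (4 ^ J)%:R :> R by rewrite ltr0n expn_gt0.
apply: le_trans (_ : \sum_(q <- almost_primes 1 (4 ^ J.+1)) (4 ^ J)%:R^-1 <= _).
  rewrite big_filter [leRHS](big_cat_nat (n := (4 ^ J)%N)) //=; first last.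
  - by rewrite leq_exp2l.
  - by rewrite expn_gt0.
  rewrite ler_wpDl //; first by rewrite sumr_ge0 // => ? _; rewrite invr_ge0 ltW.
  rewrite big_nat_cond [leRHS]big_nat_cond ler_sum // => q /andP[/andP[jq _] _].
  rewrite lef_pV2 ?posrE ?ltr0n ?ler_nat ?expn_gt0 //.
  by apply: leq_trans jq; rewrite expn_gt0.
rewrite big_const_seq count_predT iter_addr_0 -[leLHS]mulr_natr.
rewrite ler_pdivlMr ?ltr0n // -mulrA ler_pdivrMl // mulrC.
have := prime_power_count J.+1.
rewrite -(ler_nat R) natrM => h; apply: le_trans h _.
by rewrite expnS mulnA natrM mulrC.
Qed.

Lemma harmonic_sum_le_ln (R : realType) J :
  \sum_(i < J.+1) i.+1%:R^-1 <= 1 + ln J.+1%:R :> R.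
Proof.
elim: J => [|J IH]; first by rewrite big_ord_recr big_ord0 /= add0r invr1 ln1 addr0.
rewrite big_ord_recr /=; apply: le_trans (lerD IH (lexx _)) _.
have J0 : 0 < J.+1%:R :> R by [].
have J1 : 0 < J.+2%:R :> R by [].
(* The inequality ln (1 + t) <= t at t = -1/(J+2) bounds the new term by ln (J+2) - ln (J+1). *)
have := @le_ln1Dx R (- J.+2%:R^-1).
rewrite ltrN2 invf_lt1 // ltr1n => /(_ isT).
have -> : 1 - J.+2%:R^-1 = J.+1%:R / J.+2%:R :> R.
  apply: (mulIf (lt0r_neq0 J1)).
  by rewrite mulrBl mul1r mulVf ?divfK ?(lt0r_neq0 J1) // -natr1 addrK.
rewrite ln_div ?posrE // => h.
by rewrite -addrA lerD2l -lerBrDl -lerN2 opprB.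
Qed.

(** * Landau's upper bound for integers with few prime factors *)

Lemma almost_primes_count (R : realFieldType) k J :
  J%:R * (size (almost_primes k.+1 (4 ^ J)))%:R <=
    (24 * k.+1 * 4 ^ J)%:R * \sum_(m <- almost_primes k (4 ^ J)) m%:R^-1 :> R.
Proof.
apply: le_trans (ler_wpM2l _ (_ : _ <= (\sum_(m <- almost_primes k (4 ^ J))
      size [seq q <- almost_primes 1 (4 ^ J) |
             (q * m < 4 ^ J)%N && (m <= q ^ k)%N])%:R)) _.
- exact: ler0n.
- by rewrite ler_nat almost_primes_count_split.
rewrite natr_sum !mulr_sumr big_seq [leRHS]big_seq ler_sum // => m.
rewrite mem_almost_primes => /and3P[m0 _ _].
rewrite ler_pdivlMr ?ltr0n // -!natrM ler_nat.
exact: prime_power_cofactor_count.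
Qed.

Lemma almost_primes_count_ln (R : realType) k J :
  J.+1%:R * (size (almost_primes k.+1 (4 ^ J.+1)))%:R <=
    (24 * k.+1 * 4 ^ J.+1)%:R * (24 * (1 + ln J.+1%:R)) ^+ k :> R.
Proof.
apply: le_trans (almost_primes_count _ _ _) _; apply: ler_wpM2l => //.
apply: le_trans (sum_inv_almost_primes _ _ _) _.
apply: lerXn2r; rewrite ?nnegrE.
- by apply: sumr_ge0 => n _; rewrite invr_ge0.
- by rewrite mulr_ge0 // addr_ge0 // ln_ge0 // ler1n.
by apply: le_trans (sum_inv_prime_powers _ _) _;
  rewrite ler_pM2l ?harmonic_sum_le_ln.
Qed.

(** * From totient values to their preimages *)

Lemma totient_count_at_le_almost_primes (R : realType) l (x : R) i :
  x < (4 ^ i)%:R ->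
  (totient_count_at l x <= size (almost_primes l.+1 (4 ^ (i + l.+1))))%N.
Proof.
move=> xi; rewrite -(size_map totient); apply: uniq_leq_size => [|m].
  exact: fset_uniq.
rewrite in_fset_set; last exact: finite_totient_values_at_upto.
rewrite inE => -[[[n /= n0 <-] /= e] mx]; apply/map_f.
rewrite mem_almost_primes n0 /=.
have sn : (size (primes n) <= l.+1)%N.
  rewrite leqNgt; apply/negP => h.
  have : (2 ^ l.+1 %| totient n)%N.
    apply: dvdn_trans (primes_pow2_dvd_totient _ n0).
    by rewrite dvdn_exp2l // -ltnS prednK // (leq_ltn_trans _ h).
  by rewrite /dvdn e modn_small ?ltn_exp2l // expn_eq0.
rewrite sn andbT; apply: leq_ltn_trans (leq_totient_primes _ n0) _.
have mi : (totient n < 4 ^ i)%N by rewrite -(ltr_nat R); exact: le_lt_trans xi.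
(* The factor 2^(l+1) is relaxed to 4^(l+1) to keep the range a power of 4. *)
rewrite mulnC expnD; apply: leq_ltn_trans (_ : (totient n * 4 ^ l.+1 < _)%N).
  by rewrite leq_mul // (leq_trans (leq_pexp2l _ sn)) // leq_exp2r.
by rewrite ltn_pmul2r // expn_gt0.
Qed.

Theorem theorem3p4 (R : realType) (l : nat) (hl : (1 <= l)%N) :
  (fun x : R => (totient_count_at l x)%:R : R)
    =O_ +oo (fun x : R => x / ln x * ln (ln x) ^+ l).
Proof.
(* The 3 comes from L <= 3 (J+1), the middle factor from 4^(J+1) <= 4^(l+2) x, and 72 = 24 * 3 from
   1 + ln (J+1) <= 3 ln L. *)
apply/eqO_exP; exists (3 * (24 * l.+1 * 4 ^ l.+2)%:R * 72 ^+ l).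
  by rewrite !mulr_gt0 ?exprn_gt0 // ltr0n !muln_gt0 expn_gt0.
near=> x.
(* This threshold ensures ln L >= 1 and J + 1 <= 2 L + l + 2 <= L^2. *)
have hx : expR (l%:R + 4 + expR 1) <= x by near: x; exact: nbhs_pinfty_ge.
have x0 : 0 < x by apply: lt_le_trans hx; exact: expR_gt0.
have hL : l%:R + 4 + expR 1 <= ln x by rewrite -[leLHS]expRK ler_ln ?posrE ?expR_gt0.
set L := ln x in hL *.
have e0 := expR_gt0 (1 : R).
have l0 : 0 <= l%:R :> R by [].
have L0 : 0 < L by lra.
have lnL1 : 1 <= ln L by rewrite -[leLHS]expRK ler_ln ?posrE ?expR_gt0 //; lra.
have x1 : 1 <= x by rewrite leNgt; apply/negP => /ltW/ln_le0; rewrite -/L; lra.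
have N0 : (0 < Num.truncn x)%N by rewrite truncn_gt0.
have /andP[iN Ni] := trunc_log_bounds (isT : (1 < 4)%N) N0.
set i := trunc_log 4 _ in iN Ni.
have ix : (4 ^ i)%:R <= x.
  by apply: le_trans (_ : (Num.truncn x)%:R <= _); rewrite ?ler_nat // truncn_le ltW.
have xi : x < (4 ^ i.+1)%:R.
  by apply: lt_le_trans (truncnS_gt x) _; rewrite ler_nat.
have ln4l : 1 / 2 <= ln 4 :> R.
  have := @le_ln1Dx R (- (3 / 4)); rewrite (_ : 1 - 3 / 4 = 4^-1); last by field.
  rewrite lnV ?posrE //; lra.
have ln4u : ln 4 <= 3 :> R.
  have := @le_ln1Dx R 3; rewrite (_ : 1 + 3 = 4); last by ring.
  by apply; lra.
have iL : i%:R <= 2 * L.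
  have : ln (4 ^ i)%:R <= L by rewrite ler_ln ?posrE // ltr0n expn_gt0.
  rewrite natrX lnXn // -[leLHS]mulr_natr; have : 0 <= i%:R :> R by []; nra.
have Li : L <= 3 * i.+1%:R.
  have : L <= ln (4 ^ i.+1)%:R by rewrite ler_ln ?posrE ?ltW // ltr0n expn_gt0.
  rewrite natrX lnXn // -[leRHS]mulr_natr; have : 0 <= i.+1%:R :> R by []; nra.
(* Since x < 4^(i+1), preimages lie below 4^((i+1) + (l+1)) = 4^(J+1). *)
set J := (i + l.+1)%N.
have J0 : 0 < J.+1%:R :> R by [].
have JL : L <= 3 * J.+1%:R.
  by apply: le_trans Li _; rewrite ler_pM2l // ler_nat ltnS leq_addr.
have lnJ : ln J.+1%:R <= 2 * ln L.
  rewrite mulr_natl -lnXn // ler_ln ?posrE ?exprn_gt0 //.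
  rewrite /J -addn1 !natrD -addn1 natrD expr2; nra.
rewrite normr_nat ger0_norm; last first.
  by rewrite mulr_ge0 ?divr_ge0 ?exprn_ge0 ?ltW //; lra.
have h := almost_primes_count_ln R l J.
have c : (totient_count_at l x <= size (almost_primes l.+1 (4 ^ J.+1)))%N.
  by rewrite /J -addSn; exact: totient_count_at_le_almost_primes.
apply: le_trans (_ : (size (almost_primes l.+1 (4 ^ J.+1)))%:R <= _).
  by rewrite ler_nat.
rewrite -(ler_pM2l J0); apply: le_trans h _.
have hJ : (24 * l.+1 * 4 ^ J.+1)%:R <= (24 * l.+1 * 4 ^ l.+2)%:R * x.
  rewrite /J -addnS expnD [(4 ^ i * _)%N]mulnC mulnA natrM.
  by rewrite ler_wpM2l.
have hp : (24 * (1 + ln J.+1%:R)) ^+ l <= (72 * ln L) ^+ l.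
  have : 0 <= ln J.+1%:R :> R by rewrite ln_ge0 // ler1n.
  by move=> ?; apply: lerXn2r; rewrite ?nnegrE; lra.
apply: le_trans (ler_pM _ _ hJ hp) _ => //.
  by rewrite exprn_ge0 // mulr_ge0 // addr_ge0 // ln_ge0 // ler1n.
rewrite exprMn; set A := (_ * _ * _)%:R; set B := 72 ^+ l; set D := ln L ^+ l.
have -> : J.+1%:R * (3 * A * B * (x / L * D)) = A * x * (B * D) * (3 * J.+1%:R / L).
  by ring.
rewrite ler_peMr ?ler_pdivlMr ?mul1r //.
by rewrite !mulr_ge0 ?exprn_ge0 // ltW //; lra.
Unshelve. all: by end_near. Qed.
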